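(* For every derivation $\Delta$ of the sequent system $\mathsf{Gentzen}$ with premisses $\phi_1,\dots,\phi_h$ and conclusion $\psi$ there is a derivation $\Phi$ in the CoS system $\mathsf{SKSg}$ with premiss $(\phi_1\wedge\dots\wedge\phi_h)$ and conclusion $\psi$ (sequents read as disjunctions); if $n$ is the size of $\Delta$, the size of $\Phi$ is $O(n^2)$; moreover, if $\Delta$ is analytic then $\Phi$ is a derivation in $\mathsf{KSg}$.
   Context: CoS: formulae are built from units $\mathsf f,\mathsf t$, atoms $a,\bar a,\dots$, formula variables $A,\bar A,\dots$ by $[\alpha\vee\beta]$ and $(\alpha\wedge\beta)$; $\bar\cdot$ is an involution on atoms and on variables ($\bar a\ne a$); the De Morgan dual $\bar\alpha$ exchanges $\vee/\wedge$, $\mathsf t/\mathsf f$ and negates atoms and variables. Equality $=$ is the smallest context-closed equivalence containing commutativity and associativity of $\vee,\wedge$, $[\alpha\vee\mathsf f]=\alpha$, $(\alpha\wedge\mathsf t)=\alpha$, $[\mathsf t\vee\mathsf t]=\mathsf t$, $(\mathsf f\wedge\mathsf f)=\mathsf f$. A rule $\alpha/\beta$ has instances $\alpha\rho\sigma/\beta\rho\sigma$ for a renaming $\rho$ (atoms to atoms) and a substitution $\sigma$ (variables to formulae, $\bar A\mapsto$ dual); it generates steps $\xi\{\gamma\}/\xi\{\delta\}$ for any context (formula with one hole) $\xi$. A derivation in $\mathcal S$ with premiss $\alpha_0$ and conclusion $\alpha_k$ is a chain $\alpha_0,\dots,\alpha_k$ alternating $=$-steps and steps generated by rules of $\mathcal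 S$; size = number of occurrences of units, atoms and variables in it. $\mathsf{KSg}$ has rules $\mathsf t/[A\vee\bar A]$, $\mathsf f/A$, $[A\vee A]/A$, $(A\wedge[B\vee C])/[(A\wedge B)\vee C]$; $\mathsf{SKSg}$ additionally has $(A\wedge\bar A)/\mathsf f$, $A/\mathsf t$, $A/(A\wedge A)$. $\mathsf{Gentzen}$: one-sided sequents $\phi$ are multisets of CoS formulae (comma = multiset union), and a sequent $\alpha_1,\dots,\alpha_h$ is read as the formula $[\alpha_1\vee\dots\vee\alpha_h]$. Rules (with $A,B$ standing for arbitrary formulae and $\phi,\psi$ for multisets): identity $\vdash A,\bar A$; true $\vdash\mathsf t$; weakening from $\phi$ infer $\phi,A$; contraction from $\phi,A,A$ infer $\phi,A$; disjunction from $\phi,A,B$ infer $\phi,A\vee B$; conjunction from $\phi,A$ and $B,\psi$ infer $\phi,A\wedge B,\psi$; cut from $\phi,A$ and $\bar A,\psi$ infer $\phi,\psi$. Derivations are trees of rule instances; their unproved leaves are premisses and the root is the conclusion; size = number of occurrences of units, atoms and variables. A derivation is analytic if it contains no cut. An empty conjunction is represented by a conjunction of units $\mathsf t$. *)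

(* Defs.v *)
From HB Require Import structures.
From mathcomp Require Import all_boot.
From mathcomp Require Import finmap multiset.

Set Implicit Arguments.
Unset Strict Implicit.
Unset Printing Implicit Defensive.

Local Open Scope mset_scope.

(* ** Formulae *)

(* Atoms and formula variables are signed names taken from two denumerable
   alphabets; the sign carries the involution a |-> a-bar. *)
Notation literal := (bool * nat)%type.

Definition bar (a : literal) : literal := (~~ a.1, a.2).

Inductive formula : Type :=
| FF
| TT
| Atom of literal
| Var of literal
| Or of formula & formula
| And of formula & formula.

Fixpoint formula_encode (alpha : formula) : GenTree.tree (literal + literal) :=
  match alpha with
  | FF => GenTree.Node 0 [::]
  | TT => GenTree.Node 1 [::]
  | Atom a => GenTree.Leaf (inl a)
  | Var A => GenTree.Leaf (inr A)
  | Or beta gamma => GenTree.Node 2 [:: formula_encode beta; formula_encode gamma]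
  | And beta gamma => GenTree.Node 3 [:: formula_encode beta; formula_encode gamma]
  end.

Fixpoint formula_decode (t : GenTree.tree (literal + literal)) : option formula :=
  match t with
  | GenTree.Node 0 [::] => Some FF
  | GenTree.Node 1 [::] => Some TT
  | GenTree.Leaf (inl a) => Some (Atom a)
  | GenTree.Leaf (inr A) => Some (Var A)
  | GenTree.Node 2 [:: u; v] =>
      if (formula_decode u, formula_decode v) is (Some beta, Some gamma)
      then Some (Or beta gamma) else None
  | GenTree.Node 3 [:: u; v] =>
      if (formula_decode u, formula_decode v) is (Some beta, Some gamma)
      then Some (And beta gamma) else None
  | _ => None
  end.

Lemma formula_encodeK : pcancel formula_encode formula_decode.
Proof. by elim=> //= beta -> gamma ->. Qed.

HB.instance Definition _ := Countable.copy formula (pcan_type formula_encodeK).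

Fixpoint dual (alpha : formula) : formula :=
  match alpha with
  | FF => TT
  | TT => FF
  | Atom a => Atom (bar a)
  | Var A => Var (bar A)
  | Or beta gamma => And (dual beta) (dual gamma)
  | And beta gamma => Or (dual beta) (dual gamma)
  end.

Fixpoint fsize (alpha : formula) : nat :=
  match alpha with
  | Or beta gamma | And beta gamma => fsize beta + fsize gamma
  | _ => 1
  end.

(* ** Contexts and the equality of formulae *)

Inductive context : Type :=
| Hole
| OrL of context & formula
| OrR of formula & context
| AndL of context & formula
| AndR of formula & context.

Fixpoint fill (xi : context) (gamma : formula) : formula :=
  match xi with
  | Hole => gamma
  | OrL zeta beta => Or (fill zeta gamma) beta
  | OrR beta zeta => Or beta (fill zeta gamma)
  | AndL zeta beta => And (fill zeta gamma) beta
  | AndR beta zeta => And beta (fill zeta gamma)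
  end.

Inductive eqf : formula -> formula -> Prop :=
| eqf_refl alpha : eqf alpha alpha
| eqf_sym alpha beta : eqf alpha beta -> eqf beta alpha
| eqf_trans alpha beta gamma : eqf alpha beta -> eqf beta gamma -> eqf alpha gamma
| eqf_ctx xi alpha beta : eqf alpha beta -> eqf (fill xi alpha) (fill xi beta)
| eqf_orC alpha beta : eqf (Or alpha beta) (Or beta alpha)
| eqf_andC alpha beta : eqf (And alpha beta) (And beta alpha)
| eqf_orA alpha beta gamma :
    eqf (Or (Or alpha beta) gamma) (Or alpha (Or beta gamma))
| eqf_andA alpha beta gamma :
    eqf (And (And alpha beta) gamma) (And alpha (And beta gamma))
| eqf_orF alpha : eqf (Or alpha FF) alpha
| eqf_andT alpha : eqf (And alpha TT) alpha
| eqf_orTT : eqf (Or TT TT) TT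
| eqf_andFF : eqf (And FF FF) FF.

(* ** The calculus of structures *)

Fixpoint rename (rho : literal -> literal) (alpha : formula) : formula :=
  match alpha with
  | Atom a => Atom (rho a)
  | Or beta gamma => Or (rename rho beta) (rename rho gamma)
  | And beta gamma => And (rename rho beta) (rename rho gamma)
  | _ => alpha
  end.

Fixpoint subst (sigma : literal -> formula) (alpha : formula) : formula :=
  match alpha with
  | Var A => sigma A
  | Or beta gamma => Or (subst sigma beta) (subst sigma gamma)
  | And beta gamma => And (subst sigma beta) (subst sigma gamma)
  | _ => alpha
  end.

Definition is_renaming (rho : literal -> literal) : Prop :=
  {morph rho : a / bar a}.

Definition is_substitution (sigma : literal -> formula) : Prop :=
  {morph sigma : A / bar A >-> dual A}.

(* The pair (alpha, beta) stands for the rule alpha / beta. *)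
Notation rule := (formula * formula)%type.

Inductive rule_step (S : seq rule) : formula -> formula -> Prop :=
| RuleStep (r : rule) rho sigma xi :
    r \in S -> is_renaming rho -> is_substitution sigma ->
    rule_step S (fill xi (subst sigma (rename rho r.1)))
                (fill xi (subst sigma (rename rho r.2))).

Definition vA : formula := Var (true, 0).
Definition vB : formula := Var (true, 1).
Definition vC : formula := Var (true, 2).

Definition interaction : rule := (TT, Or vA (dual vA)).
Definition weakening : rule := (FF, vA).
Definition contraction : rule := (Or vA vA, vA).
Definition switch : rule := (And vA (Or vB vC), Or (And vA vB) vC).
Definition cointeraction : rule := (And vA (dual vA), FF).
Definition coweakening : rule := (vA, TT).
Definition cocontraction : rule := (vA, And vA vA).

Definition KSg : seq rule := [:: interaction; weakening; contraction; switch].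
Definition SKSg : seq rule :=
  KSg ++ [:: cointeraction; coweakening; cocontraction].

(* [alternating S b alpha s]: the chain alpha :: s alternates equality steps and
   S-steps, and its first step, if any, is an equality step iff [b]. *)
Fixpoint alternating (S : seq rule) (b : bool) (alpha : formula)
    (s : seq formula) : Prop :=
  match s with
  | [::] => True
  | beta :: s' =>
      (if b then eqf alpha beta else rule_step S alpha beta)
      /\ alternating S (~~ b) beta s'
  end.

(* A chain is a nonempty sequence, given as its head and its tail. *)
Definition chain : Type := (formula * seq formula)%type.

Definition cos_derivation (S : seq rule) (Phi : chain)
    (premiss conclusion : formula) : Prop :=
  [/\ Phi.1 = premiss, last Phi.1 Phi.2 = conclusion
    & exists b, alternating S b Phi.1 Phi.2].

Definition cos_size (Phi : chain) : nat :=
  \sum_(alpha <- Phi.1 :: Phi.2) fsize alpha.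

(* ** The sequent calculus *)

Definition sequent : Type := {mset formula}.

Definition sequent_size (phi : sequent) : nat :=
  \sum_(alpha <- enum_mset phi) fsize alpha.

(* [gentzen phi] is the type of derivation trees with conclusion phi. *)
Inductive gentzen : sequent -> Type :=
| GPremiss (phi : sequent) : gentzen phi
| GIdentity (A : formula) : gentzen ([mset A] `+` [mset dual A])
| GTrue : gentzen [mset TT]
| GWeakening (phi : sequent) (A : formula) :
    gentzen phi -> gentzen (phi `+` [mset A])
| GContraction (phi : sequent) (A : formula) :
    gentzen (phi `+` [mset A] `+` [mset A]) -> gentzen (phi `+` [mset A])
| GDisjunction (phi : sequent) (A B : formula) :
    gentzen (phi `+` [mset A] `+` [mset B]) -> gentzen (phi `+` [mset Or A B])
| GConjunction (phi psi : sequent) (A B : formula) :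
    gentzen (phi `+` [mset A]) -> gentzen ([mset B] `+` psi) ->
    gentzen (phi `+` [mset And A B] `+` psi)
| GCut (phi psi : sequent) (A : formula) :
    gentzen (phi `+` [mset A]) -> gentzen ([mset dual A] `+` psi) ->
    gentzen (phi `+` psi).

(* One entry per unproved leaf, from left to right. *)
Fixpoint premisses (psi : sequent) (Delta : gentzen psi) : seq sequent :=
  match Delta with
  | GPremiss phi => [:: phi]
  | GIdentity _ | GTrue => [::]
  | GWeakening _ _ D | GContraction _ _ D | GDisjunction _ _ _ D => premisses D
  | GConjunction _ _ _ _ D E | GCut _ _ _ D E => premisses D ++ premisses E
  end.

Fixpoint gentzen_size (psi : sequent) (Delta : gentzen psi) : nat :=
  sequent_size psi +
  match Delta with
  | GPremiss _ | GIdentity _ | GTrue => 0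
  | GWeakening _ _ D | GContraction _ _ D | GDisjunction _ _ _ D => gentzen_size D
  | GConjunction _ _ _ _ D E | GCut _ _ _ D E => gentzen_size D + gentzen_size E
  end.

Fixpoint analytic (psi : sequent) (Delta : gentzen psi) : bool :=
  match Delta with
  | GPremiss _ | GIdentity _ | GTrue => true
  | GWeakening _ _ D | GContraction _ _ D | GDisjunction _ _ _ D => analytic D
  | GConjunction _ _ _ _ D E => analytic D && analytic E
  | GCut _ _ _ _ _ => false
  end.

(* ** Sequents and lists of premisses as formulae *)

Fixpoint bigOr (s : seq formula) : formula :=
  match s with
  | [::] => FF
  | [:: alpha] => alpha
  | alpha :: s' => Or alpha (bigOr s')
  end.

Fixpoint bigAnd (s : seq formula) : formula :=
  match s with
  | [::] => TT
  | [:: alpha] => alpha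
  | alpha :: s' => And alpha (bigAnd s')
  end.

(* The disjuncts are listed in the order of [enum_mset]; by [bigOr_perm] any
   other order gives an equal formula. *)
Definition formula_of_sequent (phi : sequent) : formula := bigOr (enum_mset phi).

Lemma bigOr_cons alpha s : eqf (bigOr (alpha :: s)) (Or alpha (bigOr s)).
Proof.
case: s => [|beta s] /=; last exact: eqf_refl.
exact/eqf_sym/eqf_orF.
Qed.

Lemma bigOr_cat s t : eqf (bigOr (s ++ t)) (Or (bigOr s) (bigOr t)).
Proof.
elim: s => [|alpha s IHs] /=.
  exact/eqf_sym/(eqf_trans (eqf_orC _ _))/eqf_orF.
apply: eqf_trans (bigOr_cons _ _) _.
apply: eqf_trans (eqf_ctx (OrR alpha Hole) IHs) _.
apply: eqf_trans (eqf_sym (eqf_orA _ _ _)) _.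
exact: (eqf_ctx (OrL Hole (bigOr t)) (eqf_sym (bigOr_cons alpha s))).
Qed.

Lemma bigOr_perm s t : perm_eq s t -> eqf (bigOr s) (bigOr t).
Proof.
elim: s t => [|alpha s IHs] t st.
  by move: st; rewrite perm_sym => /perm_nilP ->; apply: eqf_refl.
have /path.splitPr t_split : alpha \in t by rewrite -(perm_mem st) mem_head.
case: t_split st => t1 t2; rewrite perm_sym -cat1s perm_catCA /= perm_cons perm_sym.
move=> /IHs IH.
apply: eqf_trans (bigOr_cons _ _) _.
apply: eqf_trans (eqf_ctx (OrR alpha Hole) IH) _ => /=.
apply: eqf_trans (eqf_ctx (OrR alpha Hole) (bigOr_cat t1 t2)) _ => /=.
apply: eqf_sym; apply: eqf_trans (bigOr_cat _ _) _.
apply: eqf_trans (eqf_ctx (OrR (bigOr t1) Hole) (bigOr_cons _ _)) _ => /=.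
apply: eqf_trans (eqf_sym (eqf_orA _ _ _)) _.
apply: eqf_trans (eqf_ctx (OrL Hole (bigOr t2)) (eqf_orC _ _)) _.
exact: eqf_orA.
Qed.

(* Main.v *)
Require Import Defs.
From mathcomp Require Import all_boot.
From mathcomp Require Import finmap multiset.
From mathcomp Require Import zify.

(* By induction on the tree, each inference is simulated by at most three rule
   steps separated by equality steps, performed inside the context formed by the
   premisses of the neighbouring branch.  Conjunction is two switches, and cut
   adds one cointeraction to them.  Every formula occurring in the simulation is
   linear in the size of the tree, and so is the number of inferences, since an
   empty sequent can only be the root or be followed by a weakening. *)

Set Implicit Arguments.
Unset Strict Implicit.
Unset Printing Implicit Defensive.

(** * Formulae and sequents *)

Lemma dualK : involutive dual.
Proof. by elim=> //= [[s i]|[s i]|a -> b ->|a -> b ->] //=; rewrite /bar /= negbK. Qed.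

Lemma fsize_dual A : fsize (dual A) = fsize A.
Proof. by elim: A => //= a -> b ->. Qed.

Lemma fsize_gt0 A : 0 < fsize A.
Proof. by elim: A => //= a Ha b Hb; rewrite addn_gt0 Ha. Qed.

Lemma eqf_or a b c d : eqf a b -> eqf c d -> eqf (Or a c) (Or b d).
Proof.
move=> ab cd; apply: eqf_trans (eqf_ctx (OrL Hole c) ab) _.
exact: (eqf_ctx (OrR b Hole) cd).
Qed.

Lemma eqf_and a b c d : eqf a b -> eqf c d -> eqf (And a c) (And b d).
Proof.
move=> ab cd; apply: eqf_trans (eqf_ctx (AndL Hole c) ab) _.
exact: (eqf_ctx (AndR b Hole) cd).
Qed.

Lemma bigAnd_cons a s : eqf (bigAnd (a :: s)) (And a (bigAnd s)).
Proof.
case: s => [|b s] /=; last exact: eqf_refl.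
exact/eqf_sym/eqf_andT.
Qed.

Lemma bigAnd_cat s t : eqf (bigAnd (s ++ t)) (And (bigAnd s) (bigAnd t)).
Proof.
elim: s => [|a s IHs].
  exact/eqf_sym/(eqf_trans (eqf_andC _ _))/eqf_andT.
apply: eqf_trans (bigAnd_cons a (s ++ t)) _.
apply: eqf_trans (eqf_and (eqf_refl a) IHs) _.
apply: eqf_trans (eqf_sym (eqf_andA _ _ _)) _.
exact: eqf_and (eqf_sym (bigAnd_cons a s)) (eqf_refl _).
Qed.

Lemma fsize_bigAnd_cons a s : fsize (bigAnd (a :: s)) <= fsize a + fsize (bigAnd s).
Proof. by case: s => [|b s] //=; rewrite leq_addr. Qed.

(** The bound is strict exactly when one of the lists is empty: its conjunction is the unit [TT], of
    size 1, which concatenation drops. *)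
Lemma fsize_bigAnd_cat s t :
  fsize (bigAnd (s ++ t)) <= fsize (bigAnd s) + fsize (bigAnd t).
Proof.
elim: s => [|a [|b s] IHs]; first exact: leq_addl.
  exact: fsize_bigAnd_cons.
by rewrite /= -addnA leq_add2l.
Qed.

(** The two sides may list the elements in different orders, so only a permutation is available;
    [bigOr_perm] turns it into an equality of formulae. *)
Lemma enum_msetD (phi psi : sequent) :
  perm_eq (enum_mset (phi `+` psi)%mset) (enum_mset phi ++ enum_mset psi).
Proof.
by apply/allP => a _ /=; rewrite count_cat !count_mem_mset msetE2.
Qed.

Lemma sequent_sizeD (phi psi : sequent) :
  sequent_size (phi `+` psi)%mset = sequent_size phi + sequent_size psi.
Proof. by rewrite /sequent_size (perm_big _ (enum_msetD _ _)) big_cat. Qed.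

Lemma sequent_size1 A : sequent_size [mset A]%mset = fsize A.
Proof. by rewrite /sequent_size enum_msetn big_seq1. Qed.

Lemma formula_of_sequentD (phi psi : sequent) :
  eqf (formula_of_sequent (phi `+` psi)%mset)
      (Or (formula_of_sequent phi) (formula_of_sequent psi)).
Proof. exact: eqf_trans (bigOr_perm (enum_msetD _ _)) (bigOr_cat _ _). Qed.

Lemma formula_of_sequent1 A : formula_of_sequent [mset A]%mset = A.
Proof. by rewrite /formula_of_sequent enum_msetn. Qed.

Lemma formula_of_sequentDl phi A :
  eqf (formula_of_sequent (phi `+` [mset A])%mset) (Or (formula_of_sequent phi) A).
Proof. by have := formula_of_sequentD phi [mset A]%mset; rewrite formula_of_sequent1. Qed.

Lemma formula_of_sequentDr phi A :
  eqf (formula_of_sequent ([mset A] `+` phi)%mset) (Or A (formula_of_sequent phi)).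
Proof. by have := formula_of_sequentD [mset A]%mset phi; rewrite formula_of_sequent1. Qed.

(* The empty sequent has size 0 but is read as the unit f, of size 1. *)
Lemma fsize_formula_of_sequent phi :
  fsize (formula_of_sequent phi) <= (sequent_size phi).+1.
Proof.
rewrite /formula_of_sequent /sequent_size.
elim: (enum_mset phi) => [|a [|b s] IHs]; first by rewrite big_nil.
  by rewrite big_seq1 leqnSn.
by rewrite big_cons /= -addnS leq_add2l.
Qed.

(** * Derivations of bounded length and width *)

(* [n] bounds the number of rule steps, equality steps being free, and [W] the size
   of every formula of the derivation. *)
Inductive derives (S : seq (formula * formula)) (W : nat) :
    nat -> formula -> formula -> Prop :=
| DerivesEq n a b :
    eqf a b -> fsize a <= W -> fsize b <= W -> derives S W n a b
| DerivesStep n a b c d :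
    eqf a b -> fsize a <= W -> fsize b <= W -> rule_step S b c ->
    derives S W n c d -> derives S W n.+1 a d.

Section Derives.

Variable S : seq (formula * formula).

Lemma derives_bound W n a b : derives S W n a b -> fsize a <= W /\ fsize b <= W.
Proof. by elim=> // {}n {}a {}b c d _ ? _ _ _ []. Qed.

Lemma derives_leq W W' n n' a b :
  W <= W' -> n <= n' -> derives S W n a b -> derives S W' n' a b.
Proof.
move=> WW' nn' D; elim: D n' nn' => [{}n {}a {}b ab Ha Hb|{}n {}a {}b c d ab Ha Hb bc _ IH] n'.
  by move=> _; apply: DerivesEq => //; apply: leq_trans WW'.
case: n' => // n' nn'; apply: DerivesStep ab _ _ bc (IH _ nn').
  exact: leq_trans WW'.
exact: leq_trans WW'.
Qed.

Lemma derives_eql W n a b c :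
  eqf a b -> fsize a <= W -> derives S W n b c -> derives S W n a c.
Proof.
move=> ab Ha D; case: D ab => [{}n {}b {}c bc _ Hc|{}n {}b c' d e bc _ Hc cd De] ab.
  exact: DerivesEq (eqf_trans ab bc) Ha Hc.
exact: DerivesStep (eqf_trans ab bc) Ha Hc cd De.
Qed.

(** The last equality step of the first derivation merges with the first one of the second, so the
    rule steps just add up. *)
Lemma derives_trans W m n a b c :
  derives S W m a b -> derives S W n b c -> derives S W (m + n) a c.
Proof.
elim=> [{}m {}a {}b ab Ha _|{}m {}a {}b c' d ab Ha Hb bc _ IH] D.
  exact: derives_leq (leqnn _) (leq_addl _ _) (derives_eql ab Ha D).
exact: DerivesStep ab Ha Hb bc (IH D).
Qed.

Lemma derives_eqr W n a b c :
  derives S W n a b -> eqf b c -> fsize c <= W -> derives S W n a c.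
Proof.
move=> D bc Hc; have [_ Hb] := derives_bound D.
by rewrite -[n]addn0; apply: derives_trans D _; apply: DerivesEq.
Qed.

Lemma derives_rule W a b : rule_step S a b ->
  fsize a <= W -> fsize b <= W -> derives S W 1 a b.
Proof.
move=> ab Ha Hb; apply: DerivesStep (eqf_refl _) _ _ ab _ => //.
exact: DerivesEq (eqf_refl b) _ _.
Qed.

(** * Derivations inside contexts *)

Fixpoint comp_context (xi zeta : context) : context :=
  match xi with
  | Hole => zeta
  | OrL xi b => OrL (comp_context xi zeta) b
  | OrR b xi => OrR b (comp_context xi zeta)
  | AndL xi b => AndL (comp_context xi zeta) b
  | AndR b xi => AndR b (comp_context xi zeta)
  end.

Lemma fill_comp xi zeta a : fill (comp_context xi zeta) a = fill xi (fill zeta a).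
Proof. by elim: xi => //= [xi -> b|b xi ->|xi -> b|b xi ->]. Qed.

Lemma rule_step_fill xi a b : rule_step S a b -> rule_step S (fill xi a) (fill xi b).
Proof. by case=> r rho sigma zeta Sr Hr Hs; rewrite -!fill_comp; apply: RuleStep. Qed.

Lemma derives_fill xi W W' n a b :
  (forall c, fsize c <= W -> fsize (fill xi c) <= W') ->
  derives S W n a b -> derives S W' n (fill xi a) (fill xi b).
Proof.
move=> HW; elim=> [{}n {}a {}b ab Ha Hb|{}n {}a {}b c d ab Ha Hb bc _ IH].
  by apply: DerivesEq (eqf_ctx _ ab) _ _; apply: HW.
by apply: DerivesStep (eqf_ctx _ ab) _ _ (rule_step_fill xi bc) IH; apply: HW.
Qed.

(** The branches run one after the other: first the left one beside the fixed [c], then the right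
    one beside the fixed [b]. *)
Lemma derives_and W1 W2 m n a b c d :
  derives S W1 m a b -> derives S W2 n c d ->
  derives S (W1 + W2) (m + n) (And a c) (And b d).
Proof.
move=> D E; have [_ Hb] := derives_bound D; have [Hc _] := derives_bound E.
apply: (@derives_trans _ _ _ _ (And b c)).
  by apply: (derives_fill (xi := AndL Hole c)) D => e He /=; apply: leq_add.
by apply: (derives_fill (xi := AndR b Hole)) E => e He /=; apply: leq_add.
Qed.

(** Each rule step contributes two formulae, its premiss and its conclusion; the other two are the
    first and the last formula of the chain. *)
Lemma derives_chain W n a b : derives S W n a b ->
  exists2 Phi : chain, cos_derivation S Phi a b & cos_size Phi <= (2 * n + 2) * W.
Proof.
suff H : derives S W n a b -> exists s,
    [/\ alternating S true a s, last a s = b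
      & \sum_(x <- a :: s) fsize x <= (2 * n + 2) * W].
  by case/H=> s [alt ls size_s]; exists (a, s) => //; split=> //; exists true.
elim=> [{}n {}a {}b ab Ha Hb|{}n {}a {}b c d ab Ha Hb bc _ [s [alt ls size_s]]].
  exists [:: b]; split=> //; rewrite big_cons big_seq1; nia.
by exists (b :: c :: s); split=> //; rewrite 2!big_cons; nia.
Qed.

Lemma cos_derivation_sub S' Phi a b :
  {subset S <= S'} -> cos_derivation S Phi a b -> cos_derivation S' Phi a b.
Proof.
move=> SS' [Ha Hb [v alt]]; split=> //; exists v; move: alt {Ha Hb}.
elim: Phi.2 Phi.1 v => //= c s IHs d v [dc /IHs alt]; split=> //.
by case: v dc {alt} => // -[r rho sigma xi /SS' Sr Hrho Hsigma]; apply: RuleStep.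
Qed.

(** * Instances of the rules *)

Definition instance (A B C : formula) (v : bool * nat) : formula :=
  let X := nth TT [:: A; B; C] v.2 in if v.1 then X else dual X.

(** [instance] follows the numbering of [vA], [vB], [vC]. Other names get the default [TT], and the
    sign selects the dual, so that it commutes with duality on all literals. *)
Lemma rule_step_instance (r : formula * formula) A B C : r \in S ->
  rule_step S (subst (instance A B C) (rename id r.1))
              (subst (instance A B C) (rename id r.2)).
Proof.
move=> Sr; apply: (@RuleStep S r id (instance A B C) Hole) => // -[[] i] //=.
by rewrite /instance /= dualK.
Qed.

(** Keeping [S] abstract lets one simulation serve both [KSg] and [SKSg]. *)
Hypothesis KSgS : {subset KSg <= S}.

Lemma interaction_step A : rule_step S TT (Or A (dual A)).
Proof.
by apply: (@rule_step_instance interaction A A A); apply: KSgS; rewrite !inE eqxx.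
Qed.

Lemma weakening_step A : rule_step S FF A.
Proof.
by apply: (@rule_step_instance weakening A A A); apply: KSgS; rewrite !inE eqxx orbT.
Qed.

Lemma contraction_step A : rule_step S (Or A A) A.
Proof.
by apply: (@rule_step_instance contraction A A A); apply: KSgS; rewrite !inE eqxx !orbT.
Qed.

Lemma switch_step A B C : rule_step S (And A (Or B C)) (Or (And A B) C).
Proof.
by apply: (@rule_step_instance switch A B C); apply: KSgS; rewrite !inE eqxx !orbT.
Qed.

Lemma cointeraction_step A :
  cointeraction \in S -> rule_step S (And A (dual A)) FF.
Proof. exact: (@rule_step_instance cointeraction A A A). Qed.

Lemma derives_switch2 W f A B g : fsize f + fsize A + fsize B + fsize g <= W ->
  derives S W 2 (And (Or f A) (Or B g)) (Or (Or f (And A B)) g).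
Proof.
(* The first switch moves [g] out, treating [Or f A] as a single conjunct; the second, after
   commutations, moves [f] out. *)
move=> HW; apply: (@derives_trans _ 1 1 _ (Or (And (Or f A) B) g)).
  by apply: derives_rule (switch_step _ _ _) _ _ => /=; lia.
apply: (@derives_eql _ _ _ (Or (And B (Or A f)) g)) => /=; last 1 first.
- apply: (@derives_eqr _ _ _ (Or (Or (And B A) f) g)) => /=; last by lia.
    apply: derives_rule => /=; [|lia|lia].
    exact: (rule_step_fill (OrL Hole g) (switch_step _ _ _)).
  apply: eqf_or (eqf_refl _); apply: eqf_trans (eqf_orC _ _) _.
  exact: eqf_or (eqf_refl _) (eqf_andC _ _).
- apply: eqf_or (eqf_refl _); apply: eqf_trans (eqf_andC _ _) _.
  exact: eqf_and (eqf_refl _) (eqf_orC _ _).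
- lia.
Qed.

End Derives.

(** * The translation *)

Fixpoint gentzen_nodes (psi : sequent) (Delta : gentzen psi) : nat :=
  match Delta with
  | GPremiss _ | GIdentity _ | GTrue => 1
  | GWeakening _ _ D | GContraction _ _ D | GDisjunction _ _ _ D =>
      (gentzen_nodes D).+1
  | GConjunction _ _ _ _ D E | GCut _ _ _ D E =>
      (gentzen_nodes D + gentzen_nodes E).+1
  end.

(* An empty sequent contributes a node but no size; being the root or the premiss
   of a weakening, it is charged to the nonempty conclusion of that weakening. *)
Lemma gentzen_nodes_leq psi (Delta : gentzen psi) :
  gentzen_nodes Delta <= 2 * gentzen_size Delta + (sequent_size psi == 0).
Proof.
elim: Delta => /= [phi|A||phi A D|phi A D|phi A B D
  |phi phi' A B D + E|phi phi' A D + E];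
  rewrite ?sequent_sizeD ?sequent_size1 /=; try have := fsize_gt0 A;
  try have := fsize_gt0 B; try have := fsize_gt0 (dual A); lia.
Qed.

Lemma sequent_size_leq psi (Delta : gentzen psi) : sequent_size psi <= gentzen_size Delta.
Proof. by case: Delta => *; apply: leq_addr. Qed.

(** The node count in the width pays for the units that stand for empty sequents. The factor 3 is
    the cost of a cut, the most expensive inference. *)
Lemma derives_gentzen S psi (Delta : gentzen psi) : {subset KSg <= S} ->
  analytic Delta || (cointeraction \in S) ->
  derives S (2 * (gentzen_size Delta + gentzen_nodes Delta)) (3 * gentzen_nodes Delta)
    (bigAnd (map formula_of_sequent (premisses Delta))) (formula_of_sequent psi).
Proof.
move=> KS; elim: Delta => /= [phi|A||phi A D IH|phi A D IH|phi A B D IH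
  |phi phi' A B D IHD E IHE|phi phi' A D IHD E IHE] HS.
- have := fsize_formula_of_sequent phi => ?.
  by apply: DerivesEq; [exact: eqf_refl|lia|lia].
- have := fsize_gt0 A => A0.
  have := fsize_formula_of_sequent ([mset A] `+` [mset dual A])%mset.
  rewrite !sequent_sizeD !sequent_size1 fsize_dual => ?.
  (* The empty list of premisses is read as [TT], the premiss of interaction. *)
  apply: (@derives_eqr _ _ _ _ (Or A (dual A))).
  + apply: (@derives_leq _ _ _ 1); [exact: leqnn|by []|].
    by apply: derives_rule (interaction_step KS A) _ _ => /=; rewrite ?fsize_dual; lia.
  + by apply: eqf_sym; rewrite -{2}[dual A]formula_of_sequent1; apply: formula_of_sequentDr.
  + lia.
- rewrite formula_of_sequent1.
  by apply: DerivesEq; [exact: eqf_refl| |]; rewrite /= sequent_size1.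
- have {}IH := IH HS.
  have f0 := fsize_formula_of_sequent phi.
  have := fsize_formula_of_sequent (phi `+` [mset A])%mset.
  rewrite !sequent_sizeD !sequent_size1 => ?.
  apply: (@derives_leq _ _ _ (3 * gentzen_nodes D + 1)); [exact: leqnn|by lia|].
  apply: (@derives_trans _ _ _ _ _ (formula_of_sequent phi)).
    by apply: derives_leq IH; lia.
  (* Equality supplies a unit [FF], which the weakening rule then replaces by [A]. *)
  apply: (@derives_eql _ _ _ _ (Or (formula_of_sequent phi) FF));
    [exact/eqf_sym/eqf_orF|lia|].
  apply: (@derives_eqr _ _ _ _ (Or (formula_of_sequent phi) A));
    [|exact/eqf_sym/formula_of_sequentDl|lia].
  apply: derives_rule => /=; [|lia|lia].
  exact: (rule_step_fill (OrR (formula_of_sequent phi) Hole) (weakening_step KS A)).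
- have {}IH := IH HS.
  have f0 := fsize_formula_of_sequent phi.
  have := fsize_formula_of_sequent (phi `+` [mset A])%mset.
  rewrite !sequent_sizeD !sequent_size1 => ?.
  have [_] := derives_bound IH; move: IH; set f2 := formula_of_sequent (_ `+` _ `+` _)%mset.
  have ef2 : eqf f2 (Or (formula_of_sequent phi) (Or A A)).
    apply: eqf_trans (formula_of_sequentDl _ _) _.
    apply: eqf_trans (eqf_or (formula_of_sequentDl _ _) (eqf_refl _)) _.
    exact: eqf_orA.
  have s2 := sequent_size_leq D.
  move: s2; rewrite !sequent_sizeD !sequent_size1 => s2 IH b2.
  apply: (@derives_leq _ _ _ (3 * gentzen_nodes D + 1)); [exact: leqnn|by lia|].
  apply: (@derives_trans _ _ _ _ _ f2); first by apply: derives_leq IH; lia.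
  apply: derives_eql ef2 _ _; first by lia.
  apply: (@derives_eqr _ _ _ _ (Or (formula_of_sequent phi) A));
    [|exact/eqf_sym/formula_of_sequentDl|lia].
  apply: derives_rule => /=; [|lia|lia].
  exact: (rule_step_fill (OrR (formula_of_sequent phi) Hole) (contraction_step KS A)).
- have {}IH := IH HS.
  have f0 := fsize_formula_of_sequent (phi `+` [mset Or A B])%mset.
  move: f0; rewrite !sequent_sizeD !sequent_size1 /= => f0.
  (* No rule step is spent here: premiss and conclusion are equal by associativity. *)
  apply: derives_eqr; first by apply: derives_leq IH; lia.
    apply: eqf_trans (formula_of_sequentDl _ _) _.
    apply: eqf_trans (eqf_or (formula_of_sequentDl _ _) (eqf_refl _)) _.
    apply: eqf_trans (eqf_orA _ _ _) _.
    exact/eqf_sym/formula_of_sequentDl.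
  lia.
- have [HD HE] : (analytic D || (cointeraction \in S)) /\
                  (analytic E || (cointeraction \in S)).
    by move: HS; case: (cointeraction \in S); rewrite ?orbT ?orbF // => /andP [-> ->].
  have {HD}IHD := IHD HD; have {HE}IHE := IHE HE.
  have f0 := fsize_formula_of_sequent phi; have f0' := fsize_formula_of_sequent phi'.
  have sD := sequent_size_leq D; have sE := sequent_size_leq E.
  have := fsize_formula_of_sequent (phi `+` [mset And A B] `+` phi')%mset.
  move: sD sE; rewrite !sequent_sizeD !sequent_size1 /= => sD sE fc.
  rewrite map_cat.
  have [pD _] := derives_bound IHD; have [pE _] := derives_bound IHE.
  have pDE := fsize_bigAnd_cat (map formula_of_sequent (premisses D))
                               (map formula_of_sequent (premisses E)).
  apply: derives_eql (bigAnd_cat _ _) _ _; first by lia.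
  apply: (@derives_leq _ _ _ (3 * gentzen_nodes D + 3 * gentzen_nodes E + 2));
    [exact: leqnn|by lia|].
  apply: derives_trans.
    by apply: derives_leq (leqnn _) (derives_and IHD IHE); lia.
  (* Both conclusions are regrouped so that the active formulae [A] and [B] stand next to each
     other, as the double switch expects. *)
  apply: derives_eql.
    exact: eqf_and (formula_of_sequentDl _ _) (formula_of_sequentDr _ _).
  + have [_ cD] := derives_bound IHD; have [_ cE] := derives_bound IHE.
    by rewrite /=; lia.
  + apply: derives_eqr; [apply: derives_switch2 => //; lia| |lia].
    apply: eqf_sym; apply: eqf_trans (formula_of_sequentD _ _) _.
    exact: eqf_or (formula_of_sequentDl _ _) (eqf_refl _).
- have [HD HE] : (analytic D || (cointeraction \in S)) /\
                  (analytic E || (cointeraction \in S)).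
    (* A derivation ending in a cut is not analytic, so [HS] reduces to the membership of
       cointeraction in [S]. *)
    by rewrite HS !orbT.
  have {HD}IHD := IHD HD; have {HE}IHE := IHE HE.
  have f0 := fsize_formula_of_sequent phi; have f0' := fsize_formula_of_sequent phi'.
  have sD := sequent_size_leq D; have sE := sequent_size_leq E.
  have := fsize_formula_of_sequent (phi `+` phi')%mset.
  have A0 := fsize_gt0 A.
  move: sD sE; rewrite !sequent_sizeD !sequent_size1 fsize_dual /= => sD sE fc.
  rewrite map_cat.
  have [pD _] := derives_bound IHD; have [pE _] := derives_bound IHE.
  have pDE := fsize_bigAnd_cat (map formula_of_sequent (premisses D))
                               (map formula_of_sequent (premisses E)).
  apply: derives_eql (bigAnd_cat _ _) _ _; first by lia.
  apply: (@derives_leq _ _ _ (3 * gentzen_nodes D + 3 * gentzen_nodes E + (2 + 1)));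
    [exact: leqnn|by lia|].
  apply: derives_trans.
    by apply: derives_leq (leqnn _) (derives_and IHD IHE); lia.
  apply: derives_eql.
    exact: eqf_and (formula_of_sequentDl _ _) (formula_of_sequentDr _ _).
  + have [_ cD] := derives_bound IHD; have [_ cE] := derives_bound IHE.
    by rewrite /=; lia.
  + apply: derives_trans; first by apply: derives_switch2 => //; rewrite fsize_dual; lia.
    set f := formula_of_sequent phi; set f' := formula_of_sequent phi'.
    (* The switches have joined the cut formula with its dual; cointeraction turns this conjunction
       into [FF], which equality absorbs. *)
    apply: (@derives_eqr _ _ _ _ (Or (Or f FF) f')); last by lia.
      apply: derives_rule => /=; rewrite ?fsize_dual /f /f'; [|lia|lia].
      exact: (rule_step_fill (OrL (OrR f Hole) f') (cointeraction_step A HS)).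
    apply: eqf_trans (eqf_or (eqf_orF _) (eqf_refl _)) _.
    exact/eqf_sym/formula_of_sequentD.
Qed.

(* The bound is O(n^2) with threshold n = 1; size 0 occurs only for the one-node
   derivation whose premiss and conclusion are the empty sequent. *)
Theorem theorem3p4 :
  exists C : nat, forall (psi : sequent) (Delta : gentzen psi),
    let premiss := bigAnd (map formula_of_sequent (premisses Delta)) in
    let conclusion := formula_of_sequent psi in
    exists Phi : chain,
      [/\ cos_derivation SKSg Phi premiss conclusion,
          0 < gentzen_size Delta -> cos_size Phi <= C * gentzen_size Delta ^ 2
        & analytic Delta -> cos_derivation KSg Phi premiss conclusion].
Proof.
exists 160 => psi Delta premiss conclusion.
(* [S] is [KSg] for an analytic derivation and [SKSg] otherwise, so that a single chain meets all
   three requirements. *)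
have [S [KS SK HS SA]] : exists S, [/\ {subset KSg <= S}, {subset S <= SKSg},
    analytic Delta || (cointeraction \in S) & analytic Delta -> S = KSg].
  case: (analytic Delta); first by exists KSg; split=> // r; rewrite mem_cat => ->.
  by exists SKSg; split=> // r; rewrite mem_cat => ->.
have [Phi D size_Phi] := derives_chain (derives_gentzen KS HS).
exists Phi; split; last by move/SA <-.
  exact: cos_derivation_sub SK D.
have := gentzen_nodes_leq Delta; move: size_Phi.
move: (gentzen_size Delta) (gentzen_nodes Delta) (cos_size Phi) => n k z Hz Hk n0.
(* For [n > 0] the node count [k] is at most [2 * n + 1 <= 3 * n]. Hence the number of formulae,
   [6 * k + 2], is at most [20 * n] and the width [2 * (n + k)] at most [8 * n], which gives 160. *)
apply: leq_trans Hz _; apply: (@leq_trans ((20 * n) * (8 * n))); last by lia.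
by apply: leq_mul; lia.
Qed.
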